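(* Let $X_1, \ldots, X_n$ be centered, independent random matrices in $\mathcal{S}_{d}$ that are sub-Gaussian with parameters $V_1, \ldots, V_n\in\mathcal{S}_d^+$ respectively. Then for all $t \geq 0$, $$\mathbb{P} \left\{ \lambda_{\min} \left(\frac{1}{n}\sum_{i=1}^n X_i \right) \geq t \right\} \leq \exp \left\{ -\frac{n t^2}{2\sigma^2} \right\},$$ where $\sigma^2 = \left\| \frac{1}{n}\sum_{i=1}^n V_i \right\|$.
   Context: $\mathcal{S}_d$ denotes the set of $d\times d$ real symmetric matrices and $\mathcal{S}_d^+$ the positive semidefinite ones. The Loewner order: for $A,B\in\mathcal{S}_d$, $A \preceq B$ means $B-A$ is positive semidefinite. $\|\cdot\|$ is the operator norm (largest singular value); $\lambda_{\min}$ denotes the smallest eigenvalue. Matrix exponentials of symmetric matrices are defined through the eigenvalues in an orthogonal diagonalization. A centered symmetric random matrix $X \in \mathcal{S}_{d}$ (i.e. $\mathbb{E}X=0$) is sub-Gaussian with parameter $V \in \mathcal{S}^+_{d}$ if, for all $\lambda \in \mathbb{R}$, $\mathbb{E}(e^{\lambda X}) \preceq e^{\lambda^2 V/2}$. *)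

(* Defs.v *)
From HB Require Import structures.
From mathcomp Require Import all_boot all_order all_algebra.
From mathcomp Require Import all_classical all_reals all_analysis.

Set Implicit Arguments.
Unset Strict Implicit.
Unset Printing Implicit Defensive.

Import Order.TTheory GRing.Theory Num.Theory.
Import numFieldNormedType.Exports.

Local Open Scope classical_set_scope.
Local Open Scope ring_scope.

Section symmetric_matrices.
Context {R : realType} {d : nat}.
Implicit Types A B : 'M[R]_d.

Lemma symmetricmxP A : reflect (A^T = A) (A \is symmetricmx).
Proof.
rewrite qualifE /= expr0 scale1r map_mx_id//.
by apply: (iffP eqP) => [<-|->].
Qed.

Definition psdmx A : Prop :=
  A \is symmetricmx /\ forall v : 'rV[R]_d, 0 <= (v *m A *m v^T) 0 0.

Definition loewner_le A B : Prop := psdmx (B - A).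

(* For symmetric A and 0 < d the set of (real) eigenvalues is finite and
   nonempty, so that this infimum is the smallest eigenvalue. *)
Definition lambda_min A : R := inf [set a | eigenvalue A a].

Definition singular_value A (s : R) : Prop :=
  0 <= s /\ eigenvalue (A^T *m A) (s ^+ 2).

(* The library norm `|A| is the largest absolute value of an entry, hence a
   separate definition; for 0 < d this supremum is a maximum. *)
Definition opnorm A : R := sup [set s | singular_value A s].

(* exp(A) = Q^T diag(exp l) Q for any orthogonal diagonalization
   A = Q^T diag(l) Q (junk value 0 if there is none, i.e. if A is not
   symmetric); mxexpE shows that the choice of (Q, l) is irrelevant. *)
Definition mxexp A : 'M[R]_d :=
  xget 0 [set B | exists (Q : 'M[R]_d) (l : 'rV[R]_d),
    [/\ Q *m Q^T = 1%:M, A = Q^T *m diag_mx l *m Q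
      & B = Q^T *m diag_mx (map_mx expR l) *m Q]].

Lemma mxexpE (Q : 'M[R]_d) (l : 'rV[R]_d) : Q *m Q^T = 1%:M ->
  mxexp (Q^T *m diag_mx l *m Q) = Q^T *m diag_mx (map_mx expR l) *m Q.
Proof.
move=> QQ; rewrite /mxexp; case: xgetP => [_ -> [Q' [l' [QQ' e ->]]]|]; last first.
  by move=> /(_ (Q^T *m diag_mx (map_mx expR l) *m Q))[]; exists Q, l.
have QtQ : Q^T *m Q = 1%:M by exact: mulmx1C.
have QtQ' : Q'^T *m Q' = 1%:M by exact: mulmx1C.
pose W := Q' *m Q^T.
have WE : W *m diag_mx l = diag_mx l' *m W.
  have : Q' *m (Q^T *m diag_mx l *m Q) *m Q^T =
         Q' *m (Q'^T *m diag_mx l' *m Q') *m Q^T by rewrite e.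
  by rewrite !mulmxA QQ' mul1mx -!mulmxA QQ mulmx1 !mulmxA.
have WexpE : W *m diag_mx (map_mx expR l) = diag_mx (map_mx expR l') *m W.
  apply/matrixP => i j; move/matrixP : WE => /(_ i j).
  rewrite !(mul_diag_mx, mul_mx_diag) !mxE mulrC => /eqP.
  rewrite -subr_eq0 -mulrBl mulf_eq0 subr_eq0 => /orP[/eqP ->|/eqP ->].
    by rewrite mulrC.
  by rewrite mul0r mulr0.
have -> : Q^T *m diag_mx (map_mx expR l) *m Q =
    Q'^T *m (W *m diag_mx (map_mx expR l)) *m Q.
  by rewrite /W !mulmxA QtQ' mul1mx.
by rewrite WexpE /W -!mulmxA QtQ mulmx1.
Qed.

End symmetric_matrices.

(* 'M[R]_d with its Borel sigma-algebra. *)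
Notation borel_mx R d := (g_sigma_algebraType (@open 'M[R]_d)).

Section random_matrices.
Context {disp : measure_display} {T : measurableType disp} {R : realType}.
Variable P : probability T R.

Definition mutually_independent (I : finType) (disp' : measure_display)
    (T' : measurableType disp') (X : I -> {RV P >-> T'}) : Prop :=
  forall (J : {set I}) (B : I -> set T'),
    (forall i, i \in J -> measurable (B i)) ->
    P (\bigcap_(i in [set` J]) (X i @^-1` B i)) =
      (\prod_(i in J) P (X i @^-1` B i))%E.

Context {d : nat}.
Implicit Types (X : T -> 'M[R]_d) (V : 'M[R]_d).

Definition mx_integrable X : Prop :=
  forall i j, P.-integrable setT (fun w => (X w i j)%:E).

(* Entrywise; meaningful only under mx_integrable. *)
Definition mx_expectation X : 'M[R]_d :=
  \matrix_(i, j) fine ('E_P[fun w => X w i j])%E.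

Definition centered X : Prop := mx_integrable X /\ mx_expectation X = 0.

Definition sub_gaussian X V : Prop := forall lambda : R,
  mx_integrable (fun w => mxexp (lambda *: X w)) /\
  loewner_le (mx_expectation (fun w => mxexp (lambda *: X w)))
             (mxexp ((lambda ^+ 2 / 2) *: V)).

End random_matrices.

(* Main.v *)
Require Import Defs.
From HB Require Import structures.
From mathcomp Require Import all_boot all_order all_algebra.
From mathcomp Require Import all_classical all_reals all_analysis.
From mathcomp Require Import measurable_realfun complex ring lra zify.
Import Order.TTheory GRing.Theory Num.Theory.
Import numFieldNormedType.Exports.
Local Open Scope classical_set_scope.
Local Open Scope ring_scope.
Set Implicit Arguments.
Unset Strict Implicit.
Unset Printing Implicit Defensive.

(* For symmetric A and B, Jensen's inequality in the two eigenbases gives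
   d exp((tr A + tr B)/d) <= tr(exp A exp B). With A = -(l^2/2) V and B = l X
   the sub-Gaussian hypothesis yields
     E exp((l tr X - (l^2/2) tr V)/d) <= tr(exp(-(l^2/2) V) E exp(l X))/d <= 1,
   a scalar bound in which the traces of the V_i simply add up; taking V into
   the exponential on the left avoids Lieb's concavity theorem. On the event,
   all eigenvalues of the mean are >= t, hence so is tr/d of the mean, and
   independence and Chernoff's bound conclude, since the normalized trace of
   the mean of the V_i is at most its operator norm. *)

(** * Orthogonal diagonalization of real symmetric matrices *)

Lemma rowmx_sqr_norm_ge0 (R : realDomainType) d (v : 'rV[R]_d) :
  0 <= (v *m v^T) 0 0.
Proof. by rewrite mxE sumr_ge0// => j _; rewrite mxE -expr2 sqr_ge0. Qed.

Lemma rowmx_sqr_norm_eq0 (R : realDomainType) d (v : 'rV[R]_d) :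
  ((v *m v^T) 0 0 == 0) = (v == 0).
Proof.
apply/eqP/eqP => [|->]; last by rewrite mul0mx mxE.
rewrite mxE => /eqP; rewrite psumr_eq0; last first.
  by move=> j _; rewrite mxE -expr2 sqr_ge0.
move=> /allP v0; apply/rowP => j; rewrite mxE.
by have := v0 j (mem_index_enum _); rewrite mxE -expr2 sqrf_eq0 => /eqP.
Qed.

(** The characteristic polynomial has a root over [R[i]]. Symmetry forces this eigenvalue to be
    real, so the real and imaginary parts of a complex eigenvector both satisfy the real eigenvector
    equation, and one of them is nonzero. *)
Lemma symmetric_eigenvector (R : rcfType) d (A : 'M[R]_d.+1) : A^T = A ->
  exists (a : R) (v : 'rV[R]_d.+1), v != 0 /\ v *m A = a *: v.
Proof.
move=> symA.
have [z /eigenvalueP[v vA v0]] : exists z : R[i],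
    eigenvalue (map_mx (real_complex R) A) z.
  exact: eigenvalue_closed.
pose x := map_mx (@complex.Re R) v; pose y := map_mx (@complex.Im R) v.
have xA : x *m A = complex.Re z *: x - complex.Im z *: y.
  apply/rowP => j; have /rowP/(_ j)/(congr1 (@complex.Re R)) := vA.
  rewrite !mxE raddf_sum /=.
  have -> : complex.Re (z * v 0 j) =
      complex.Re z * complex.Re (v 0 j) - complex.Im z * complex.Im (v 0 j).
    by case: (z) (v 0 j) => ? ? [].
  move=> <-; apply: eq_bigr => i _; rewrite !mxE.
  by case: (v 0 i) => p q /=; rewrite mulr0 subr0.
have yA : y *m A = complex.Re z *: y + complex.Im z *: x.
  apply/rowP => j; have /rowP/(_ j)/(congr1 (@complex.Im R)) := vA.
  rewrite !mxE raddf_sum /=.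
  have -> : complex.Im (z * v 0 j) =
      complex.Re z * complex.Im (v 0 j) + complex.Im z * complex.Re (v 0 j).
    by case: (z) (v 0 j) => ? ? [].
  move=> <-; apply: eq_bigr => i _; rewrite !mxE.
  by case: (v 0 i) => p q /=; rewrite mulr0 add0r.
have xy0 : (x != 0) || (y != 0).
  rewrite -negb_and; apply: contra v0 => /andP[/eqP/rowP x0 /eqP/rowP y0].
  apply/eqP/rowP => j; move: (x0 j) (y0 j); rewrite !mxE.
  by case: (v 0 j) => p q /= -> ->.
have xyC : x *m y^T = y *m x^T.
  by apply/matrixP => i j; rewrite !mxE !ord1; apply: eq_bigr => k _; rewrite !mxE mulrC.
(* The two bilinear values agree by symmetry; expanding them with [xA] and [yA] leaves
   [Im z * (|x|^2 + |y|^2) = 0]. *)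
have Im0 : complex.Im z = 0.
  have : (x *m A *m y^T) 0 0 = (y *m A *m x^T) 0 0.
    rewrite -[LHS]/((x *m A *m y^T) (0 : 'I_1) 0) -[x *m A *m _]trmxK mxE.
    by rewrite !trmx_mul trmxK symA mulmxA.
  rewrite xA yA !mulmxDl mulNmx -!scalemxAl xyC.
  move: (rowmx_sqr_norm_eq0 x) (rowmx_sqr_norm_eq0 y) (rowmx_sqr_norm_ge0 x)
    (rowmx_sqr_norm_ge0 y).
  move: (x *m x^T) (y *m y^T) (y *m x^T) => xx yy yx xx0 yy0 xx_ge0 yy_ge0.
  rewrite !mxE => /addrI/eqP.
  rewrite -subr_eq0 -opprD oppr_eq0 -mulrDr mulf_eq0 => /orP[/eqP//|].
  rewrite paddr_eq0// xx0 yy0.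
  by move: xy0; rewrite -negb_and andbC => /negP.
move: xA yA; rewrite Im0 !scale0r subr0 addr0 => xA yA.
by exists (complex.Re z); case/orP: xy0 => ?; [exists x|exists y].
Qed.

(* [H] is the reflection exchanging [v] and the first basis vector. *)
Lemma householder (R : rcfType) d (v : 'rV[R]_d.+1) : v *m v^T = 1%:M ->
  exists H : 'M[R]_d.+1, [/\ H^T = H, H *m H = 1%:M & row 0 H = v].
Proof.
move=> v1; pose e : 'rV[R]_d.+1 := delta_mx 0 0.
have e1 : e *m e^T = 1%:M.
  by rewrite trmx_delta mul_delta_mx; apply/matrixP => i j; rewrite !ord1 !mxE.
have [->|ve] := eqVneq v e.
  by exists 1%:M; rewrite trmx1 mulmx1; split=> //; rewrite rowE mulmx1.
pose u := v - e; pose s := (u *m u^T) 0 0.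
have s0 : s != 0 by rewrite rowmx_sqr_norm_eq0 subr_eq0.
have uu : u *m u^T = s%:M by exact: mx11_scalar.
exists (1%:M - (2 / s) *: (u^T *m u)); split.
- by rewrite linearB/= linearZ/= trmx_mul trmxK trmx1.
- have NN : (u^T *m u) *m (u^T *m u) = s *: (u^T *m u).
    by rewrite mulmxA -[u^T *m u *m u^T]mulmxA uu mul_mx_scalar -scalemxAl.
  have MM : ((2 / s) *: (u^T *m u)) *m ((2 / s) *: (u^T *m u)) =
      (2 / s) *: (u^T *m u) + (2 / s) *: (u^T *m u).
    rewrite -scalemxAl -scalemxAr NN !scalerA -scalerDl.
    by congr (_ *: _); field.
  move: MM; move: (_ *: _) => M MM.
  rewrite mulmxBl mul1mx [M *m _]mulmxBr mulmx1 MM opprB addrK.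
  by rewrite subrK.
rewrite rowE -/e mulmxBr mulmx1 -scalemxAr mulmxA.
pose c := (v *m e^T) 0 0.
have ve' : v *m e^T = c%:M by exact: mx11_scalar.
have ev : e *m v^T = c%:M by rewrite -[LHS]trmxK trmx_mul trmxK ve' tr_scalar_mx.
(* Both [v] and [e] are unit vectors. Hence [e *m u^T] is [- (s / 2)], and the reflection sends [e]
   to [e + u = v]. *)
have sE : s = 2 * (1 - c).
  rewrite /s /u linearB/= mulmxBl !mulmxBr v1 e1 ve' ev !mxE eqxx/= !mulr1n.
  by ring.
have -> : e *m u^T = (- (s / 2))%:M.
  by rewrite linearB/= mulmxBr e1 ev -raddfB/=; congr (_%:M); rewrite sE; field.
rewrite mul_scalar_mx scalerA mulrN mulrA divfK// mulfV// scaleN1r opprK.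
by rewrite addrC subrK.
Qed.

(** Deflation by induction on the dimension: conjugating by the reflection that moves a unit
    eigenvector to the first basis vector splits off a 1 x 1 block, and the complementary block is
    again symmetric. *)
Lemma symmetric_diagonalization (R : rcfType) d (A : 'M[R]_d) : A^T = A ->
  exists (Q : 'M[R]_d) (l : 'rV[R]_d),
    Q *m Q^T = 1%:M /\ A = Q^T *m diag_mx l *m Q.
Proof.
elim: d A => [A _|d IH A symA].
  by exists 1%:M, 0; split; apply/matrixP => -[].
have [a [w [w0 wA]]] := symmetric_eigenvector symA.
pose r := Num.sqrt ((w *m w^T) 0 0).
have r0 : r != 0.
  by rewrite sqrtr_eq0 -ltNge lt_def rowmx_sqr_norm_eq0 w0 rowmx_sqr_norm_ge0.
pose v := r^-1 *: w.
have v1 : v *m v^T = 1%:M.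
  rewrite linearZ/= -scalemxAl -scalemxAr scalerA [w *m _]mx11_scalar.
  rewrite -[_ 0 0]sqr_sqrtr ?rowmx_sqr_norm_ge0// -/r scale_scalar_mx.
  by congr (_%:M); field.
have vA : v *m A = a *: v by rewrite -scalemxAl wA !scalerA mulrC.
have [H [symH HH rH]] := householder v1.
pose B : 'M[R]_(1 + d) := H *m A *m H.
have symB : B^T = B by rewrite /B !trmx_mul symH symA mulmxA.
have rB : row 0 B = a *: delta_mx 0 0.
  rewrite /B !row_mul rH vA -scalemxAl -rH rowE -mulmxA HH mulmx1.
  by congr (_ *: _); apply/rowP => j; rewrite !mxE.
have AE : A = H *m B *m H by rewrite /B !mulmxA HH mul1mx -mulmxA HH mulmx1.
move: B symB rB AE => B symB rB AE.
(* Phrased through [val] so that it applies directly to the shifted indices of the block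
   projections. *)
have B0 (i j : 'I_(1 + d)) : val i = 0%N -> B i j = a *+ (val j == 0%N).
  move=> i0; have -> : i = 0 :> 'I_d.+1 by exact: val_inj.
  by move/rowP : rB => /(_ j); rewrite !mxE mulr_natr.
have ulB : ulsubmx B = a%:M.
  by apply/matrixP => i j; rewrite !mxE !ord1 B0.
have urB : ursubmx B = 0.
  by apply/matrixP => i j; rewrite !mxE !ord1 B0.
have dlB : dlsubmx B = 0 by rewrite -symB -trmx_ursub urB trmx0.
have symD : (drsubmx B)^T = drsubmx B by rewrite trmx_drsub symB.
have [Q' [l' [QQ' DE]]] := IH _ symD.
pose K : 'M[R]_(1 + d) := block_mx 1%:M 0 0 Q'.
have KT : K^T = block_mx 1%:M 0 0 Q'^T by rewrite tr_block_mx !trmx0 trmx1.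
have KK : K *m K^T = 1%:M.
  rewrite KT mulmx_block !(mulmx0, mul0mx) !addr0 add0r QQ' mulmx1.
  by rewrite -scalar_mx_block.
have BE : B = K^T *m diag_mx (row_mx a%:M l') *m K.
  rewrite -[LHS]submxK ulB urB dlB DE diag_mx_row.
  have -> : diag_mx (a%:M : 'rV[R]_1) = a%:M.
    by apply/matrixP => i j; rewrite !mxE !ord1 eqxx.
  rewrite KT !mulmx_block.
  by rewrite !(mulmx0, mul0mx, mulmx1, mul1mx, addr0, add0r).
exists (K *m H), (row_mx a%:M l'); split.
  by rewrite trmx_mul symH !mulmxA -(mulmxA K) HH mulmx1.
by rewrite trmx_mul symH AE BE !mulmxA.
Qed.

(** * Eigenvalue, trace and exponential inequalities for symmetric matrices *)

Section symmetric_matrices.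
Context {R : realType} {d : nat}.
Implicit Types A B C D Q U : 'M[R]_d.

Lemma eigenvalue_orthogonal_diag Q (l : 'rV[R]_d) a : Q *m Q^T = 1%:M ->
  eigenvalue (Q^T *m diag_mx l *m Q) a -> exists j, a = l 0 j.
Proof.
move=> QQ /eigenvalueP[v vA v0].
have uA : (v *m Q^T) *m diag_mx l = a *: (v *m Q^T).
  by rewrite scalemxAl -vA !mulmxA -[RHS]mulmxA QQ mulmx1.
have /rV0Pn[j uj] : v *m Q^T != 0.
  apply: contra v0 => /eqP vQ0.
  by rewrite -[v]mulmx1 -(mulmx1C QQ) mulmxA vQ0 mul0mx.
exists j; move/rowP : uA => /(_ j).
by rewrite mul_mx_diag [LHS]mxE [RHS]mxE mulrC => /(mulIf uj).
Qed.

Lemma row_orthogonal_diag Q (l : 'rV[R]_d) j : Q *m Q^T = 1%:M ->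
  row j Q *m (Q^T *m diag_mx l *m Q) = l 0 j *: row j Q.
Proof.
move=> QQ; rewrite -row_mul !mulmxA QQ mul1mx row_mul; apply/rowP => k.
rewrite !mxE (bigD1 j)//= !mxE eqxx mulr1n big1 ?addr0// => i ij.
by rewrite !mxE eq_sym (negbTE ij) mulr0n mul0r.
Qed.

Lemma row_orthogonal_sqr_norm Q j : Q *m Q^T = 1%:M ->
  row j Q *m (row j Q)^T = 1%:M.
Proof.
move=> /matrixP/(_ j j) QQ; apply/matrixP => a b; rewrite !ord1 [RHS]mxE eqxx.
rewrite -[RHS]/1 -[RHS](_ : (1%:M : 'M[R]_d) j j = 1) ?[X in X = _]mxE ?eqxx//.
by rewrite -QQ !mxE; apply: eq_bigr => k _; rewrite !mxE.
Qed.

Lemma mxtrace_orthogonal_diag Q (l : 'rV[R]_d) : Q *m Q^T = 1%:M ->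
  \tr (Q^T *m diag_mx l *m Q) = \sum_j l 0 j.
Proof. by move=> QQ; rewrite mxtrace_mulC mulmxA QQ mul1mx mxtrace_diag. Qed.

(** Rayleigh's characterization, read off in eigenbasis coordinates. It replaces the infimum by
    inequalities linear in [A], which serve both the trace bound and the measurability of the
    event. *)
Lemma lambda_minP A t : (0 < d)%N -> A^T = A ->
  t <= lambda_min A <->
  forall v : 'rV[R]_d, t * (v *m v^T) 0 0 <= (v *m A *m v^T) 0 0.
Proof.
move=> d0 symA; have [Q [l [QQ AE]]] := symmetric_diagonalization symA.
split=> [tA v|tA].
  have tl j : t <= l 0 j.
    apply: le_trans tA _; apply: ge_inf; last first.
      apply/eigenvalueP; exists (row j Q).
        by rewrite AE row_orthogonal_diag.
      rewrite -rowmx_sqr_norm_eq0 row_orthogonal_sqr_norm// mxE eqxx.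
      exact: oner_neq0.
    (* The infimum is a lower bound only if the set is bounded below; this crude bound suffices
       because every eigenvalue is some [l 0 k]. *)
    exists (- \sum_k `|l 0 k|) => a /=; rewrite AE => /eigenvalue_orthogonal_diag.
    move=> /(_ QQ)[k ->]; rewrite lerNl (le_trans (ler_norm _))// normrN.
    by rewrite (bigD1 k)//= lerDl sumr_ge0.
  have -> : v = (v *m Q^T) *m Q by rewrite -mulmxA (mulmx1C QQ) mulmx1.
  move: (v *m Q^T) => u.
  rewrite AE trmx_mul !mulmxA -!(mulmxA _ Q Q^T) QQ !mulmx1.
  rewrite !mxE mulr_sumr; apply: ler_sum => j _.
  rewrite mul_mx_diag !mxE -!expr2 mulrAC -expr2 [leRHS]mulrC.
  by rewrite ler_wpM2r// sqr_ge0.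
apply: lb_le_inf.
  exists (l 0 (Ordinal d0)); apply/eigenvalueP; exists (row (Ordinal d0) Q).
    by rewrite AE row_orthogonal_diag.
  rewrite -rowmx_sqr_norm_eq0 row_orthogonal_sqr_norm// mxE eqxx.
  exact: oner_neq0.
move=> a /= /eigenvalueP[v vA v0]; move: (tA v).
rewrite vA -scalemxAl [leRHS]mxE ler_pM2r//.
by rewrite lt_def rowmx_sqr_norm_eq0 v0 rowmx_sqr_norm_ge0.
Qed.

Lemma lambda_min_le_mxtrace A t : (0 < d)%N -> A^T = A ->
  t <= lambda_min A -> d%:R * t <= \tr A.
Proof.
move=> d0 symA /(lambda_minP _ d0 symA) tA.
rewrite mulr_natl -[X in _ *+ X]card_ord -sumr_const; apply: ler_sum => j _.
have := tA (delta_mx 0 j).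
rewrite trmx_delta mul_delta_mx -rowE -colE !mxE.
by rewrite eqxx/= mulr1.
Qed.

(** The trace is the sum of [d] eigenvalues, and each eigenvalue of a positive semidefinite matrix
    is also a singular value, with eigenvector [row j Q]. *)
Lemma mxtrace_le_opnorm A : psdmx A -> \tr A <= d%:R * opnorm A.
Proof.
move=> [/symmetricmxP symA A0].
have [Q [l [QQ AE]]] := symmetric_diagonalization symA.
rewrite {1}AE mxtrace_orthogonal_diag// mulr_natl -[X in _ *+ X]card_ord.
rewrite -sumr_const; apply: ler_sum => j _.
have rowA : row j Q *m A = l 0 j *: row j Q by rewrite AE row_orthogonal_diag.
apply: ub_le_sup.
  (* The supremum needs an upper bound: [s ^+ 2] is one of the [l 0 k ^+ 2], and [s <= 1 + s ^+ 2]
     avoids taking square roots. *)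
  exists (1 + \sum_k l 0 k ^+ 2) => s [s0]; rewrite symA.
  have -> : A *m A = Q^T *m diag_mx (map_mx (fun x => x ^+ 2) l) *m Q.
    rewrite AE !mulmxA -[_ *m Q *m Q^T]mulmxA QQ mulmx1; congr (_ *m _).
    rewrite -mulmxA; congr (_ *m _); rewrite mul_diag_mx.
    apply/matrixP => a b; rewrite !mxE.
    by case: eqVneq => [->|_]; rewrite ?mulr0n ?mulr1n ?mulr0// expr2.
  move=> /eigenvalue_orthogonal_diag => /(_ QQ)[k]; rewrite mxE => sE.
  have le_s : s <= 1 + s ^+ 2 by nra.
  rewrite (le_trans le_s)// lerD2l sE (bigD1 k)//= lerDl sumr_ge0// => i _.
  exact: sqr_ge0.
split.
  have := A0 (row j Q); rewrite rowA -scalemxAl row_orthogonal_sqr_norm//.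
  by rewrite !mxE eqxx mulr1.
apply/eigenvalueP; exists (row j Q).
  by rewrite symA mulmxA rowA -scalemxAl rowA scalerA expr2.
rewrite -rowmx_sqr_norm_eq0 row_orthogonal_sqr_norm// mxE eqxx.
exact: oner_neq0.
Qed.

(** In the eigenbasis of [A] the trace is a sum of positive exponentials times values of the
    quadratic form of [D] at the rows of [Q]. This is how a Loewner inequality becomes a scalar
    one. *)
Lemma mxtrace_mxexp_mul_ge0 A D : A^T = A -> psdmx D -> 0 <= \tr (mxexp A *m D).
Proof.
move=> symA [_ D0]; have [Q [l [QQ AE]]] := symmetric_diagonalization symA.
rewrite AE mxexpE// -!mulmxA mxtrace_mulC -!mulmxA mul_diag_mx.
apply: sumr_ge0 => j _; rewrite mxE mxE mulr_ge0 ?expR_ge0//.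
have := D0 (row j Q); rewrite -row_mul tr_row mulmxA.
by rewrite !mxE; under eq_bigr do rewrite [row _ _ _ _]mxE [col _ _ _ _]mxE.
Qed.

Lemma mxexpN_mul A : A^T = A -> mxexp (- A) *m mxexp A = 1%:M.
Proof.
move=> symA; have [Q [l [QQ AE]]] := symmetric_diagonalization symA.
have NAE : - A = Q^T *m diag_mx (- l) *m Q.
  by rewrite AE raddfN/= mulmxN mulNmx.
rewrite NAE AE !mxexpE// !mulmxA -[_ *m Q *m Q^T]mulmxA QQ mulmx1.
rewrite -(mulmx1C QQ); congr (_ *m _); rewrite -[RHS]mulmx1 -mulmxA.
congr (_ *m _); rewrite mul_diag_mx; apply/matrixP => a b; rewrite !mxE.
case: eqVneq => [->|_]; rewrite ?mulr0n ?mulr1n ?mulr0//.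
by rewrite expRN mulVf// gt_eqF// expR_gt0.
Qed.

(* Jensen's inequality for [expR] and the [d^2] weights [W j k ^+ 2 / d], where
   the orthogonal matrix [W] relates the eigenbases of [A] and [B]. *)
Lemma expR_mxtraceD_le A B : (0 < d)%N -> A^T = A -> B^T = B ->
  d%:R * expR ((\tr A + \tr B) / d%:R) <= \tr (mxexp A *m mxexp B).
Proof.
move=> d0 symA symB.
have [Q [a [QQ AE]]] := symmetric_diagonalization symA.
have [U [b [UU BE]]] := symmetric_diagonalization symB.
rewrite AE BE !mxexpE// !mxtrace_orthogonal_diag//.
(* [W] is introduced opaquely. Its squared entries form a doubly stochastic matrix ([W1], [W2]),
   which provides the Jensen weights. *)
have [W WE] : {W | W = Q *m U^T} by exists (Q *m U^T).
have WW : W *m W^T = 1%:M.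
  by rewrite WE trmx_mul trmxK mulmxA -[_ *m U]mulmxA (mulmx1C UU) mulmx1.
have W1 j : \sum_k W j k ^+ 2 = 1.
  move/matrixP : WW => /(_ j j); rewrite !mxE eqxx mulr1n => <-.
  by apply: eq_bigr => k _; rewrite [W^T _ _]mxE expr2.
have W2 k : \sum_j W j k ^+ 2 = 1.
  move/matrixP : (mulmx1C WW) => /(_ k k); rewrite !mxE eqxx mulr1n => <-.
  by apply: eq_bigr => j _; rewrite [W^T _ _]mxE expr2.
have -> : \tr (Q^T *m diag_mx (map_mx expR a) *m Q *m
               (U^T *m diag_mx (map_mx expR b) *m U)) =
    \sum_j \sum_k expR (a 0 j + b 0 k) * W j k ^+ 2.
  rewrite -!mulmxA mxtrace_mulC -!mulmxA mul_diag_mx.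
  rewrite /mxtrace; apply: eq_bigr => j _.
  have -> : Q *m (U^T *m (diag_mx (map_mx expR b) *m (U *m Q^T))) =
      W *m diag_mx (map_mx expR b) *m W^T.
    by rewrite WE trmx_mul trmxK !mulmxA.
  rewrite [LHS]mxE [X in X * _]mxE [X in _ * X]mxE mulr_sumr; apply: eq_bigr => k _.
  by rewrite mul_mx_diag 2!mxE [W^T _ _]mxE expRD; ring.
have dR0 : d%:R != 0 :> R by rewrite pnatr_eq0 -lt0n.
set m := (_ / _).
(* The left side becomes a weighted sum of values of the tangent line of [expR] at [m]. Since [m] is
   the weighted mean of the [a 0 j + b 0 k], the linear terms cancel, and a termwise comparison with
   [1 + x <= expR x] remains. *)
have -> : d%:R * expR m =
    \sum_j \sum_k expR m * (1 + (a 0 j + b 0 k - m)) * W j k ^+ 2.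
  have -> : \sum_j \sum_k expR m * (1 + (a 0 j + b 0 k - m)) * W j k ^+ 2 =
      expR m * (\sum_j \sum_k (1 - m) * W j k ^+ 2 +
      \sum_j \sum_k a 0 j * W j k ^+ 2 + \sum_j \sum_k b 0 k * W j k ^+ 2).
    rewrite -!big_split/= mulr_sumr; apply: eq_bigr => j _.
    rewrite -!big_split/= mulr_sumr; apply: eq_bigr => k _.
    by ring.
  rewrite [X in _ + X]exchange_big/=.
  under eq_bigr do rewrite -mulr_sumr W1.
  under [X in _ + X + _]eq_bigr do rewrite -mulr_sumr W1 mulr1.
  under [X in _ + X]eq_bigr do rewrite -mulr_sumr W2 mulr1.
  rewrite sumr_const card_ord -mulr_natl.
  have mE : \sum_j a 0 j = m * d%:R - \sum_j b 0 j by rewrite /m divfK// addrK.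
  by rewrite mE; ring.
apply: ler_sum => j _; apply: ler_sum => k _.
rewrite ler_wpM2r ?sqr_ge0//.
have -> : expR (a 0 j + b 0 k) = expR m * expR (a 0 j + b 0 k - m).
  by rewrite -expRD [m + _]addrC subrK.
by rewrite ler_pM2l ?expR_gt0// expR_ge1Dx.
Qed.

End symmetric_matrices.

(** * Expectation of a product of independent variables *)

Section independence.
Context {disp : measure_display} {T : measurableType disp} {R : realType}.
Context {disp' : measure_display} {T' : measurableType disp'}.

Import HBNNSimple.

Lemma integral_mul_nnsfun_comp (mu : {measure set T -> \bar R}) (G : T -> R)
    (Z : T -> T') (f : {nnsfun T' >-> R}) :
    measurable_fun setT G -> (forall x, 0 <= G x) -> measurable_fun setT Z ->
  (\int[mu]_x (G x * f (Z x))%:E =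
   \sum_(y \in range f) y%:E * \int[mu]_x (G x * \1_(f @^-1` [set y]) (Z x))%:E)%E.
Proof.
move=> mG G0 mZ.
transitivity (\int[mu]_x (\sum_(y \in range f)
    (G x * (y * \1_(f @^-1` [set y]) (Z x)))%:E))%E.
  apply: eq_integral => x _; rewrite [X in G x * X]fimfunE mulr_fsumr//.
  by rewrite -fsumEFin.
have m1 y : measurable_fun setT (fun x => G x * \1_(f @^-1` [set y]) (Z x)).
  apply: measurable_funM => //; apply: measurableT_comp => //.
rewrite ge0_integral_fsum//; last 2 first.
- move=> y; apply/measurable_EFinP; under eq_fun do rewrite mulrCA.
  exact: measurable_funM.
- by move=> y x _; rewrite lee_fin mulr_ge0// -lee_fin EFinM nnfun_muleindic_ge0.
apply: eq_fsbigr => y /set_mem[x _ yE].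
under eq_integral do rewrite mulrCA EFinM.
rewrite ge0_integralZl_EFin//.
- by move=> z _; rewrite lee_fin mulr_ge0.
- exact/measurable_EFinP.
- by rewrite -yE.
Qed.

(** The standard extension from indicators to nonnegative measurable functions: first simple
    functions by linearity, then increasing limits by monotone convergence. *)
Lemma ge0_integral_mul_comp (mu : {measure set T -> \bar R}) (c : R)
    (G : T -> R) (Z : T -> T') (f : T' -> R) :
    measurable_fun setT G -> (forall x, 0 <= G x) -> measurable_fun setT Z ->
    measurable_fun setT f -> (forall x, 0 <= f x) ->
    (forall B, measurable B ->
      \int[mu]_x (G x * \1_B (Z x))%:E = c%:E * mu (Z @^-1` B))%E ->
  (\int[mu]_x (G x * f (Z x))%:E = c%:E * \int[mu]_x (f (Z x))%:E)%E.
Proof.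
move=> mG G0 mZ mf f0 GZ.
have mEf : measurable_fun setT (EFin \o f) by exact/measurable_EFinP.
have Ef0 x : [set: T'] x -> (0 <= (EFin \o f) x)%E by rewrite lee_fin.
pose f_ := nnsfun_approx measurableT mEf.
have f_cvg x : (f_ n x)%:E @[n --> \oo] --> (f x)%:E.
  exact: cvg_nnsfun_approx.
have f_nd x : {homo f_ ^~ x : m n / (m <= n)%N >-> m <= n}.
  by move=> m n mn; exact/lefP/nd_nnsfun_approx.
have cvgL (H : T -> R) : measurable_fun setT H -> (forall x, 0 <= H x) ->
    (\int[mu]_x (H x * f_ n (Z x))%:E @[n --> \oo] -->
     \int[mu]_x (H x * f (Z x))%:E)%E.
  move=> mH H0; rewrite (_ : (fun x => _) = fun x => limn (fun n => (H x * f_ n (Z x))%:E)).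
    apply: cvg_monotone_convergence => //.
    - move=> n; apply/measurable_EFinP/measurable_funM => //.
      exact: measurableT_comp.
    - by move=> n x _; rewrite lee_fin mulr_ge0.
    - by move=> x _ m n mn; rewrite lee_fin ler_wpM2l// f_nd.
  apply/funext => x; apply/esym/cvg_lim => //.
  under eq_fun do rewrite EFinM.
  by rewrite EFinM; apply: cvgeZl.
(* The factor [1] on the right lets the same decomposition over the values of [f_ n] apply to both
   sides, with [G] and with [cst 1]. *)
have f_E n : (\int[mu]_x (G x * f_ n (Z x))%:E =
    c%:E * \int[mu]_x (1 * f_ n (Z x))%:E)%E.
  rewrite integral_mul_nnsfun_comp// (@integral_mul_nnsfun_comp mu (cst 1)) //.
  rewrite ge0_mule_fsumr; last first.
    (* Distributing [c%:E] over the sum requires nonnegative terms. A negative [y] is not a value of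
       [f_ n], so its integral vanishes. *)
    move=> y; have [y0|y0] := ltP y 0; last first.
      by rewrite mule_ge0// integral_ge0// => x _; rewrite lee_fin mulr_ge0.
    rewrite [X in (_ * X)%E]integral0_eq ?mule0// => x _; rewrite indicE memNset ?mulr0//=.
    by move=> fy; move: y0; rewrite -fy ltNge fun_ge0.
  apply: eq_fsbigr => y _.
  have mB : measurable (f_ n @^-1` [set y]) by [].
  rewrite GZ// muleCA; congr (_ * (_ * _))%E.
  under eq_integral do rewrite mul1r.
  rewrite (_ : (fun x => _) = (fun x => (\1_(Z @^-1` (f_ n @^-1` [set y])) x)%:E)).
    rewrite integral_indic ?setIT//.
    by rewrite -[X in measurable X]setTI; exact: mZ.
  by apply/funext.
have := cvgL G mG G0; under eq_fun do rewrite f_E.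
move=> /cvg_lim <- //.
apply/cvg_lim => //; apply: cvgeZl => //.
have := cvgL (cst 1); rewrite /=; under eq_integral do rewrite mul1r.
by apply => //; exact: measurable_cst.
Qed.

Lemma integral_prod_independent (P : probability T R) (n : nat)
    (X : 'I_n -> {RV P >-> T'}) (f : 'I_n -> T' -> R) :
    mutually_independent X -> (forall i, measurable_fun setT (f i)) ->
    (forall i x, 0 <= f i x) ->
    (forall i, (\int[P]_w (f i (X i w))%:E < +oo)%E) ->
  (\int[P]_w (\prod_i f i (X i w))%:E = \prod_i \int[P]_w (f i (X i w))%:E)%E.
Proof.
move=> indepX.
have mX i : measurable_fun setT (X i) by exact: measurable_funPT.
(* The indicators are replaced by arbitrary functions one index at a time. *)
suff main k : forall f : 'I_n -> T' -> R, (forall i, measurable_fun setT (f i)) ->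
    (forall i x, 0 <= f i x) ->
    (forall i, (\int[P]_w (f i (X i w))%:E < +oo)%E) ->
    (forall i : 'I_n, (k <= i)%N -> exists2 B, measurable B & f i = \1_B) ->
    (\int[P]_w (\prod_i f i (X i w))%:E = \prod_i \int[P]_w (f i (X i w))%:E)%E.
  move=> mf f0 foo; apply: (main n) => // i.
  by rewrite leqNgt ltn_ord.
elim: k => [|k IH] {}f mf f0 foo fB.
  (* Base case: every factor is an indicator, and the claim is mutual independence for the full
     index set. *)
  have [B mB fE] : exists2 B : 'I_n -> set T', (forall i, measurable (B i)) &
      forall i, f i = \1_(B i).
    have /choice[B BP] : forall i, exists B, measurable B /\ f i = \1_B.
      by move=> i; have [B] := fB i isT; exists B.
    by exists B => i; have [] := BP i.
  have := indepX [set: 'I_n]%SET B (fun i _ => mB i).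
  rewrite (_ : \bigcap_(i in _) _ = \bigcap_i (X i @^-1` B i)); last first.
    by apply: eq_bigcapl; split=> i //= _; rewrite inE.
  move=> PB; transitivity (P (\bigcap_i (X i @^-1` B i))); last first.
    rewrite PB; apply: eq_big => [i|i _]; first by rewrite inE.
    rewrite fE (_ : (fun x => _) = (fun x => (\1_(X i @^-1` B i) x)%:E))//.
    by rewrite integral_indic ?setIT// -[X in measurable X]setTI; exact: mX.
  rewrite -[RHS](_ : (\int[P]_w (\1_(\bigcap_i (X i @^-1` B i)) w)%:E)%E = _); last first.
    rewrite integral_indic ?setIT//.
    apply: fin_bigcap_measurable => // i _.
    by rewrite -[X in measurable X]setTI; exact: mX.
  apply: eq_integral => w _; congr EFin; rewrite indicE.
  have [inB|] := boolP (w \in _).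
    rewrite big1// => i _; rewrite fE indicE mem_set//.
    by move: inB; rewrite inE; exact.
  move=> /negP; rewrite inE => /existsNP[k].
  move=> /not_implyP[_ /= Bi]; rewrite (bigD1 k)//= fE indicE memNset//.
  by rewrite mul0r.
have [nk|kn] := leqP n k.
  by apply: IH => // i ki; apply: fB; move: (ltn_ord i); lia.
pose j := Ordinal kn.
(* With an indicator at index [j = k] the induction hypothesis applies. This gives the integral of
   the other factors against every indicator of [X j], as [ge0_integral_mul_comp] requires in order
   to restore [f j]. *)
pose g B (i : 'I_n) := if i == j then \1_B else f i : T' -> R.
have g_prod B w : \prod_i g B i (X i w) =
    (\prod_(i | i != j) f i (X i w)) * \1_B (X j w).
  rewrite (bigD1 j)//= mulrC /g eqxx; congr (_ * _).
  by apply: eq_bigr => i /negbTE ->.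
have gj B : measurable B -> (\int[P]_w (g B j (X j w))%:E)%E = P (X j @^-1` B).
  move=> mB; rewrite /g eqxx.
  rewrite (_ : (fun x => _) = (fun x => (\1_(X j @^-1` B) x)%:E))//.
  by rewrite integral_indic ?setIT// -[X in measurable X]setTI; exact: mX.
have g_int B : measurable B -> (\int[P]_w (\prod_i g B i (X i w))%:E =
    (\prod_(i | i != j) \int[P]_w (f i (X i w))%:E) * P (X j @^-1` B))%E.
  move=> mB; rewrite IH.
  - rewrite (bigD1 j)//= muleC gj//; congr (_ * _)%E.
    by apply: eq_bigr => i; rewrite /g => /negbTE ->.
  - by move=> i; rewrite /g; case: ifP.
  - by move=> i x; rewrite /g; case: ifP.
  - move=> i; have [->|ij] := eqVneq i j.
      rewrite gj// (le_lt_trans (probability_le1 _ _)) ?ltry//.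
      by rewrite -[X in measurable X]setTI; exact: mX.
    by rewrite /g (negbTE ij).
  - move=> i ki; rewrite /g; case: eqVneq => ij; first by exists B.
    apply: fB; rewrite ltn_neqAle ki andbT; apply: contra ij => /eqP ki'.
    by apply/eqP/val_inj.
(* Finiteness allows this product to be used as the real constant [c] of [ge0_integral_mul_comp]. *)
have prod_fin : (\prod_(i | i != j) \int[P]_w (f i (X i w))%:E)%E \is a fin_num.
  apply: (big_ind (fun x => x \is a fin_num)) => // [x y|i _].
    exact: fin_numM.
  by rewrite ge0_fin_numE// integral_ge0// => x _; rewrite lee_fin.
rewrite [RHS](bigD1 j)//= muleC -[X in (X * _)%E](fineK prod_fin).
rewrite -(@ge0_integral_mul_comp P _
  (fun w => \prod_(i | i != j) f i (X i w)) (X j) (f j))//.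
- by apply: eq_integral => w _; rewrite (bigD1 j)//= mulrC.
- under eq_fun do rewrite -big_filter; apply: measurable_prod => i _.
  exact: measurableT_comp.
- by move=> x; exact: prodr_ge0.
- by move=> B mB; rewrite fineK// -g_int//; apply: eq_integral => w _; rewrite g_prod.
Qed.
End independence.

(** * Random symmetric matrices *)

Section random_matrices.
Context {R : realType} {d : nat}.

Lemma measurable_mx_entry (i j : 'I_d) :
  measurable_fun setT (fun M : borel_mx R d => (M : 'M[R]_d) i j).
Proof.
apply: (measurability _ (RGenOpens.measurableE R)) => _ [_ [a [b ->]] <-].
rewrite setTI; apply: sub_sigma_algebra.
apply: open_comp => [M _|]; first exact: coord_continuous.
exact: interval_open.
Qed.

Lemma measurable_mxtrace :
  measurable_fun setT (fun M : borel_mx R d => \tr (M : 'M[R]_d)).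
Proof. by apply: measurable_sum => i; exact: measurable_mx_entry. Qed.

Lemma mxquadE (M : 'M[R]_d) (v : 'rV[R]_d) :
  (v *m M *m v^T) 0 0 = \sum_j \sum_i v 0 i * M i j * v 0 j.
Proof.
rewrite mxE; apply: eq_bigr => j _; rewrite [v^T _ _]mxE mxE mulr_suml.
by apply: eq_bigr.
Qed.

Lemma continuous_mxquad (M : 'M[R]_d) :
  continuous (fun v : 'rV[R]_d => (v *m M *m v^T) 0 0).
Proof.
rewrite [X in continuous X](_ : _ =
    fun v : 'rV[R]_d => \sum_j \sum_i v 0 i * M i j * v 0 j).
  apply: continuous_big => [|j _]; first exact: add_continuous.
  apply: continuous_big => [|i _]; first exact: add_continuous.
  move=> v; have vC k := @coord_continuous R 1 d 0 k v.
  have c1 := continuousM (vC i) (@cst_continuous _ _ (M i j) v).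
  exact: continuousM c1 (vC j).
by apply/funext => v; rewrite mxquadE.
Qed.

(** A negative value would persist on a neighborhood by continuity, and that neighborhood contains a
    rational vector. Testing only countably many vectors is what yields measurability. *)
Lemma mxquad_rat_ge0 (M : 'M[R]_d) :
  (forall v : 'rV[rat]_d, 0 <= (map_mx ratr v *m M *m (map_mx ratr v)^T) 0 0) ->
  forall v : 'rV[R]_d, 0 <= (v *m M *m v^T) 0 0.
Proof.
move=> M0 v; rewrite leNgt; apply/negP => v_lt0.
have : nbhs v [set u : 'rV[R]_d | (u *m M *m u^T) 0 0 < 0].
  exact: (@continuous_mxquad M v _ (lt_nbhsl v_lt0)).
move=> /nbhs_ballP[e /= e0 ve].
have /choice[q qE] : forall j, exists q : rat, ball (v 0 j) e (ratr q).
  move=> j; have [|q] := @rat_in_itvoo R (v 0 j - e) (v 0 j + e); first by lra.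
  rewrite in_itv/= => /andP[q1 q2]; exists q.
  by rewrite /ball/= ltr_norml; apply/andP; split; lra.
have := M0 (\row_j q j); rewrite leNgt => /negP; apply; apply: ve.
by split=> // a j; rewrite !mxE ord1.
Qed.

Context {disp : measure_display} {T : measurableType disp}.

Lemma measurable_le_lambda_min (S : T -> 'M[R]_d) (t : R) : (0 < d)%N ->
    (forall i j, measurable_fun setT (fun w => S w i j)) ->
    (forall w, (S w)^T = S w) ->
  measurable [set w | t <= lambda_min (S w)].
Proof.
move=> d0 mS symS.
pose q (v : 'rV[rat]_d) w : R :=
  (map_mx ratr v *m (S w - t%:M) *m (map_mx ratr v)^T) 0 0.
have mSt i j : measurable_fun setT (fun w => (S w - t%:M) i j).
  rewrite (_ : (fun w => _) = (fun w => S w i j - (t%:M : 'M[R]_d) i j)).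
    exact: measurable_funB.
  by apply/funext => w; rewrite !mxE.
have mq v : measurable_fun setT (q v).
  rewrite (_ : q v = fun w => \sum_j \sum_i
      map_mx ratr v 0 i * (S w - t%:M) i j * map_mx ratr v 0 j).
    apply: measurable_sum => j; apply: measurable_sum => i.
    by apply: measurable_funM => //; exact: measurable_funM.
  by apply/funext => w; exact: mxquadE.
(* Rational vectors are enumerated by their codes; a number that codes no vector contributes the
   whole space. *)
rewrite (_ : [set w | _] = \bigcap_k
    (if @unpickle 'rV[rat]_d k is Some v then [set w | 0 <= q v w] else setT)).
  apply: bigcapT_measurable => k; case: unpickle => [v|//].
  rewrite -[X in measurable X]setTI.
  exact: (@measurable_fun_le _ _ _ setT (cst 0)).
have qE w v : (v *m (S w - t%:M) *m v^T) 0 0 =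
    (v *m S w *m v^T) 0 0 - t * (v *m v^T) 0 0.
  rewrite mulmxBr mulmxBl mul_mx_scalar -scalemxAl.
  by move: (v *m S w *m v^T) (v *m v^T) => a b; rewrite !mxE.
apply/seteqP; split=> w /=.
  move=> /(lambda_minP _ d0 (symS w)) St k _; case: unpickle => [v|//] /=.
  by rewrite /q qE subr_ge0.
move=> Sq; apply/(lambda_minP _ d0 (symS w)) => v; rewrite -subr_ge0 -qE.
apply: mxquad_rat_ge0 => {}v.
by have := Sq (pickle v) I; rewrite pickleK.
Qed.

Lemma integral_mxtrace_mul (P : probability T R) (C : 'M[R]_d)
    (Y : T -> 'M[R]_d) : mx_integrable P Y ->
  P.-integrable setT (fun w => (\tr (C *m Y w))%:E) /\
  (\int[P]_w (\tr (C *m Y w))%:E = (\tr (C *m mx_expectation P Y))%:E)%E.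
Proof.
move=> iY.
have iCY i j : P.-integrable setT (fun w => ((C i j)%:E * (Y w j i)%:E)%E).
  exact: integrableZl.
have iCYs i : P.-integrable setT (fun w => (\sum_j (C i j)%:E * (Y w j i)%:E)%E).
  exact: integrable_sum.
have trE : (fun w => (\tr (C *m Y w))%:E) =
    (fun w => \sum_i \sum_j (C i j)%:E * (Y w j i)%:E)%E.
  apply/funext => w; rewrite -sumEFin; apply: eq_bigr => i _.
  by rewrite mxE -sumEFin.
rewrite trE; split; first exact: integrable_sum.
rewrite integral_sum// -sumEFin; apply: eq_bigr => i _.
rewrite integral_sum// mxE -sumEFin; apply: eq_bigr => j _.
rewrite integralZl// mxE EFinM; congr (_ * _)%E.
by rewrite unlock fineK// integrable_fin_num.
Qed.

(** The trace inequality for [- W] and [l *: X w] bounds the integrand by [h], whose integral is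
    linear in the expected matrix exponential. The sub-Gaussian hypothesis then replaces that
    expectation by [mxexp W], and [mxexp (- W) *m mxexp W] has trace [d]. *)
Lemma integral_expR_mxtrace_le1 (P : probability T R)
    (X : {RV P >-> borel_mx R d}) (V : 'M[R]_d) (l : R) : (0 < d)%N ->
    (forall w, (X w : 'M[R]_d)^T = X w) -> psdmx V ->
    sub_gaussian P X V ->
  (\int[P]_w (expR ((l * \tr (X w : 'M[R]_d) - l ^+ 2 / 2 * \tr V) / d%:R))%:E
    <= 1)%E.
Proof.
move=> d0 symX [/symmetricmxP symV V0] /(_ l)[iX XV].
have dR0 : 0 < d%:R :> R by rewrite ltr0n.
pose W := (l ^+ 2 / 2) *: V.
have symW : W^T = W by rewrite linearZ/= symV.
have symNW : (- W)^T = - W by rewrite linearN/= symW.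
pose h w := d%:R^-1 * \tr (mxexp (- W) *m mxexp (l *: (X w : 'M[R]_d))).
have [i_tr int_tr] := integral_mxtrace_mul (mxexp (- W)) iX.
have i_h : P.-integrable setT (fun w => (h w)%:E).
  by under eq_fun do rewrite /h EFinM; exact: integrableZl.
have h_int : (\int[P]_w (h w)%:E = (d%:R^-1 * \tr (mxexp (- W) *m
    mx_expectation P (fun w => mxexp (l *: (X w : 'M[R]_d)))))%:E)%E.
  by under eq_integral do rewrite /h EFinM; rewrite integralZl// int_tr.
apply: (@le_trans _ _ (\int[P]_w (h w)%:E)%E).
  apply: ge0_le_integral => //.
  - apply/measurable_EFinP; apply: measurableT_comp => //.
    apply: measurable_funM => //; apply: measurable_funB => //.
    apply: measurable_funM => //.
    by apply: (measurableT_comp measurable_mxtrace); exact: measurable_funPT.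
  - exact: measurable_int i_h.
  - move=> w _; rewrite lee_fin /h [leRHS]mulrC ler_pdivlMr// [leLHS]mulrC.
    apply: le_trans (expR_mxtraceD_le d0 symNW _); last by rewrite linearZ/= symX.
    by rewrite linearN/= !linearZ/= addrC.
rewrite h_int lee_fin mulrC ler_pdivrMr// mul1r.
have : 0 <= \tr (mxexp (- W) *m (mxexp W -
    mx_expectation P (fun w => mxexp (l *: (X w : 'M[R]_d))))).
  by apply: mxtrace_mxexp_mul_ge0.
by rewrite mulmxBr linearB/= mxexpN_mul// mxtrace1 subr_ge0.
Qed.

End random_matrices.

(** * Stability of positive semidefiniteness and the Chernoff bound *)

Lemma psdmx_sum (R : realType) (d : nat) (I : finType) (V : I -> 'M[R]_d) :
  (forall i, psdmx (V i)) -> psdmx (\sum_i V i).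
Proof.
move=> V0; split.
  apply/symmetricmxP; rewrite linear_sum/=; apply: eq_bigr => i _.
  by apply/symmetricmxP; case: (V0 i).
move=> v; rewrite mulmx_sumr mulmx_suml summxE sumr_ge0// => i _.
by case: (V0 i).
Qed.

Lemma psdmxZ (R : realType) (d : nat) (a : R) (V : 'M[R]_d) :
  0 <= a -> psdmx V -> psdmx (a *: V).
Proof.
move=> a0 [/symmetricmxP symV V0]; split.
  by apply/symmetricmxP; rewrite linearZ/= symV.
by move=> v; rewrite -scalemxAr -scalemxAl mxE mulr_ge0.
Qed.

Lemma mxtrace_psdmx_ge0 (R : realType) (d : nat) (V : 'M[R]_d) :
  psdmx V -> 0 <= \tr V.
Proof.
move=> [_ V0]; apply: sumr_ge0 => i _; have := V0 (delta_mx 0 i).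
by rewrite trmx_delta -rowE -colE !mxE.
Qed.

(** The Chernoff bound before optimization. The parameter [l] stays free because there is no optimal
    finite choice when the variance proxy vanishes and [0 < t]. *)
Lemma probability_lambda_min_ge_le (R : realType) (disp : measure_display)
    (T : measurableType disp) (P : probability T R) (n d : nat)
    (X : 'I_n -> {RV P >-> borel_mx R d}) (V : 'I_n -> 'M[R]_d) (t l : R) :
    (0 < n)%N -> (0 < d)%N -> 0 <= l ->
    (forall i w, (X i w : 'M[R]_d) \is symmetricmx) ->
    mutually_independent X ->
    (forall i, psdmx (V i)) -> (forall i, sub_gaussian P (X i) (V i)) ->
  (P [set w | t <= lambda_min (n%:R^-1 *: \sum_(i < n) (X i w : 'M[R]_d))]%R <=
   (expR (n%:R * (l ^+ 2 / 2 * opnorm (n%:R^-1 *: \sum_(i < n) V i) - l * t)))%:E)%E.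
Proof.
move=> n0 d0 l0 symX indepX V0 subG.
have nR0 : 0 < n%:R :> R by rewrite ltr0n.
have dR0 : 0 < d%:R :> R by rewrite ltr0n.
set S := fun w => n%:R^-1 *: \sum_(i < n) (X i w : 'M[R]_d).
set s := opnorm _; set a := _ * (_ - _).
have symS w : (S w)^T = S w.
  rewrite linearZ linear_sum/=; congr (_ *: _); apply: eq_bigr => i _.
  exact/symmetricmxP.
have mXij k i j : measurable_fun setT (fun w => (X k w : 'M[R]_d) i j).
  by apply: (measurableT_comp (measurable_mx_entry i j)); exact: measurable_funPT.
have mS i j : measurable_fun setT (fun w => S w i j).
  rewrite (_ : (fun w => _) = (fun w => n%:R^-1 * \sum_(k < n) (X k w : 'M[R]_d) i j)).
    by apply: measurable_funM => //; exact: measurable_sum.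
  by apply/funext => w; rewrite mxE summxE.
have mE : measurable [set w | t <= lambda_min (S w)].
  exact: measurable_le_lambda_min.
pose f i (M : borel_mx R d) :=
  expR ((l * \tr (M : 'M[R]_d) - l ^+ 2 / 2 * \tr (V i)) / d%:R).
have mf i : measurable_fun setT (f i).
  apply: measurableT_comp => //; apply: measurable_funM => //.
  apply: measurable_funB => //; apply: measurable_funM => //.
  exact: measurable_mxtrace.
have f1 i : (\int[P]_w (f i (X i w))%:E <= 1)%E.
  by apply: integral_expR_mxtrace_le1 => // w; exact/symmetricmxP.
have f_prod w : \prod_i f i (X i w) =
    expR ((l * \tr (\sum_i (X i w : 'M[R]_d)) - l ^+ 2 / 2 * \tr (\sum_i V i)) / d%:R).
  rewrite -expR_sum; congr expR; rewrite !raddf_sum/= !mulr_sumr -sumrB.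
  by rewrite mulr_suml.
have mprod : measurable_fun setT (fun w => \prod_i f i (X i w)).
  apply: measurable_prod => i _; apply: (measurableT_comp (mf i)).
  exact: measurable_funPT.
(* Pointwise form of Markov's inequality: on the event, [n d t <= tr (sum X_i)] and
   [tr (sum V_i) <= n d s] make the total exponent nonnegative. *)
have E_le w : \1_[set w | t <= lambda_min (S w)] w <= expR a * \prod_i f i (X i w).
  rewrite indicE; have [|_] := boolP (w \in _); last first.
    by rewrite mulr_ge0 ?expR_ge0// prodr_ge0// => i _; exact: expR_ge0.
  rewrite inE /= => /(lambda_min_le_mxtrace d0 (symS w)).
  rewrite /S linearZ/= ler_pdivlMl// => trX.
  have : \tr (n%:R^-1 *: \sum_i V i) <= d%:R * s.
    by apply/mxtrace_le_opnorm/psdmxZ; [rewrite invr_ge0 ltW|exact: psdmx_sum].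
  rewrite linearZ/= ler_pdivrMl// => trV.
  rewrite f_prod -expRD -[leLHS]/(1 : R) -[leLHS]expR0 ler_expR.
  rewrite -(pmulr_lge0 _ dR0) mulrDl divfK ?gt_eqF// /a.
  have l2 : 0 <= l ^+ 2 / 2 by rewrite divr_ge0// sqr_ge0.
  have := ler_wpM2l l0 trX; have := ler_wpM2l l2 trV.
  move: (l ^+ 2 / 2) (\tr _) (\tr _) => b x y.
  lra.
apply: (@le_trans _ _ (\int[P]_w (expR a * \prod_i f i (X i w))%:E)%E).
  rewrite -[X in P X]setIT -integral_indic//.
  apply: ge0_le_integral => //.
  - exact/measurable_EFinP.
  - by apply/measurable_EFinP; exact: measurable_funM.
  - by move=> w _; rewrite lee_fin.
under eq_integral do rewrite EFinM.
rewrite ge0_integralZl_EFin ?expR_ge0//.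
- rewrite -[leRHS]mule1 lee_pmul2l ?lte_fin ?expR_gt0//.
  rewrite integral_prod_independent//.
  + suff /andP[] : (0 <= \prod_i \int[P]_w (f i (X i w))%:E <= 1)%E by [].
    (* Nonnegativity is carried along because products of upper bounds in [\bar R] need it. *)
    apply: (big_ind (fun x => 0 <= x <= 1)%E) => [|x y /andP[x0 x1] /andP[y0 y1]|i _].
    * by rewrite lee01 lexx.
    * by rewrite mule_ge0//= -[leRHS]mule1 lee_pmul.
    * by rewrite f1 integral_ge0// => w _; rewrite lee_fin expR_ge0.
  + by move=> i M; exact: expR_ge0.
  + by move=> i; rewrite (le_lt_trans (f1 i))// ltry.
- by move=> w _; rewrite lee_fin prodr_ge0// => i _; exact: expR_ge0.
- exact/measurable_EFinP.
Qed.

Unset Implicit Arguments.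

(* The bound is an extended real: for sigma2 = 0 it is exp(-oo) = 0 if 0 < t
   and exp(0) = 1 if t = 0, since 0^-1 = +oo and 0 * +oo = 0 in \bar R. *)
Theorem theorem2p17 (R : realType) (disp : measure_display)
    (T : measurableType disp) (P : probability T R) (n d : nat)
    (X : 'I_n -> {RV P >-> borel_mx R d}) (V : 'I_n -> 'M[R]_d)
    (n_gt0 : (0 < n)%N) (d_gt0 : (0 < d)%N)
    (X_sym : forall i w, (X i w : 'M[R]_d) \is symmetricmx)
    (X_centered : forall i, centered P (X i))
    (X_indep : mutually_independent X)
    (V_psd : forall i, psdmx (V i))
    (X_subG : forall i, sub_gaussian P (X i) (V i))
    (t : R) (t_ge0 : 0 <= t) :
  let sigma2 := opnorm (n%:R^-1 *: \sum_(i < n) V i) in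
  (P [set w | t <= lambda_min (n%:R^-1 *: \sum_(i < n) (X i w : 'M[R]_d))]%R <=
   expeR (- ((n%:R * t ^+ 2)%R%:E / (2 * sigma2)%R%:E)))%E.
Proof.
cbv zeta; set sigma2 := opnorm _; set E := [set w | _].
have nR0 : 0 < n%:R :> R by rewrite ltr0n.
have PE l : 0 <= l -> (P E <= (expR (n%:R * (l ^+ 2 / 2 * sigma2 - l * t)))%:E)%E.
  by move=> l0; exact: probability_lambda_min_ge_le.
have : 0 <= sigma2.
  rewrite -(@pmulr_rge0 _ d%:R) ?ltr0n//.
  apply: le_trans (mxtrace_le_opnorm _); first apply: mxtrace_psdmx_ge0.
    by apply: psdmxZ; [rewrite invr_ge0 ltW|exact: psdmx_sum].
  by apply: psdmxZ; [rewrite invr_ge0 ltW|exact: psdmx_sum].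
rewrite le_eqVlt => /predU1P[s0|s_gt0]; last first.
  (* [t / sigma2] minimizes the quadratic exponent in [l]. *)
  apply: le_trans (PE (t / sigma2) _) _; first by rewrite divr_ge0// ltW.
  have s2 : (2 * sigma2 == 0) = false by rewrite gt_eqF// mulr_gt0.
  rewrite inver s2 -EFinM -EFinN/= lee_fin ler_expR.
  by rewrite le_eqVlt; apply/orP; left; apply/eqP; field; rewrite gt_eqF.
move: PE; rewrite -s0 mulr0 inve0.
have [<-|t0] := eqVneq 0 t.
  move=> /(_ 0 (lexx _)); rewrite !expr0n/= !mulr0 mul0e oppe0 expeR0.
  by rewrite !(mulr0, mul0r, subr0, expR0).
have t_gt0 : 0 < t by rewrite lt_def eq_sym t0.
(* Here [sigma2 = 0] and [0 < t], so the target is [P E <= 0], the limit of the bounds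
   [expR (- n l t)] as [l] grows. *)
move=> PE; rewrite gt0_muley ?lte_fin ?mulr_gt0// ?exprn_gt0//=.
have fE : P E \is a fin_num.
  by rewrite ge0_fin_numE// (le_lt_trans (PE 0 (lexx _)))// ltry.
rewrite leNgt; apply/negP => p_gt0.
pose p := fine (P E); have p0 : 0 < p.
  by rewrite -lte_fin fineK.
have pE l : 0 <= l -> p <= expR (n%:R * (0 - l * t)).
  move=> l0; rewrite -lee_fin fineK//.
  by have := PE l l0; rewrite mulr0.
(* This single value of [l] replaces the limit: it gives [p <= expR (- p^-1)], contradicting
   [p^-1 < 1 + p^-1 <= expR p^-1]. *)
have l0 : 0 <= (p * (n%:R * t))^-1 by rewrite invr_ge0 ltW// !mulr_gt0.
have := pE _ l0.
have -> : n%:R * (0 - (p * (n%:R * t))^-1 * t) = - p^-1.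
  by field; rewrite !gt_eqF.
rewrite expRN leNgt => /negP; apply.
rewrite -[ltRHS]invrK ltf_pV2 ?posrE ?expR_gt0 ?invr_gt0//.
by apply: lt_le_trans (expR_ge1Dx _); rewrite ltrDr.
Qed.
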